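(* Let $E$ be a row-finite directed graph and let $\rho$ be a congruence on the Leavitt path algebra $L_{\mathbb{B}}(E)$ over the Boolean semifield $\mathbb{B}$ which is different from the diagonal congruence. Then at least one of the following is true: (1) $(v,0)\in\rho$ for some $v\in E^0$; (2) $(p(c),q(c))\in\rho$ for some cycle $c$ in $E$ without exits and some distinct polynomials $p(x),q(x)\in\mathbb{B}[x,x^{-1}]$.
   Context: The Boolean semifield is $\mathbb{B}=(\{0,1\},\vee,\wedge,0,1)$. A $\mathbb{B}$-algebra is a $\mathbb{B}$-semimodule (commutative monoid with unital $\mathbb{B}$-action, so idempotent addition) with an associative bilinear multiplication, not necessarily unital. A congruence on a hemiring $A$ (in particular on a $\mathbb{B}$-algebra) is an equivalence relation $\rho$ such that $(a,b)\in\rho$ and $s\in A$ imply $(s+a,s+b),(sa,sb),(as,bs)\in\rho$; the diagonal congruence is $\{(a,a)\mid a\in A\}$. A directed graph $E=(E^0,E^1,s,r)$ has disjoint sets $E^0$ of vertices, $E^1$ of edges and maps $s,r\colon E^1\to E^0$. It is row-finite if $|s^{-1}(v)|<\infty$ for all $v\in E^0$. A vertex $v$ is regular if $0<|s^{-1}(v)|<\infty$. A path is a sequence $p=e_1\dots e_n$ of edges with $r(e_i)=s(e_{i+1})$, with $s(p)=s(e_1)$, $r(p)=r(e_n)$; vertices are paths of length $0$. A cycle based at $v$ is a path $c=e_1\dots e_n$ with $n\ge1$, $s(c)=r(c)=v$ and $s(e_1),\dots,s(e_n)$ distinct. An exit for $c$ is an edge $f$ with $s(f)=s(e_i)$ and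 $f\neq e_i$ for some $i$. $L_{\mathbb{B}}(E)$ is the (not necessarily unital) $\mathbb{B}$-algebra generated by $E^0\cup E^1\cup\{e^*\mid e\in E^1\}$ subject to: (1) $vw=\delta_{v,w}v$ for $v,w\in E^0$; (2) $s(e)e=e=er(e)$ and $r(e)e^*=e^*=e^*s(e)$ for $e\in E^1$; (3) $e^*f=\delta_{e,f}r(e)$ for $e,f\in E^1$; (4) $v=\sum_{e\in s^{-1}(v)}ee^*$ for every regular vertex $v$. That is, it is the quotient of the free $\mathbb{B}$-algebra on these generators by the congruence generated by these relations. For a path $p=e_1\dots e_n$, $p^*=e_n^*\dots e_1^*$. $\mathbb{B}[x,x^{-1}]$ is the semiring of Laurent polynomials over $\mathbb{B}$. For a cycle $c$ based at $v$, set $c^0=v$ and $c^{-n}=(c^* )^n$ for $n\in\mathbb{N}$, and for $p(x)=\sum_{i=m}^n s_ix^i\in\mathbb{B}[x,x^{-1}]$ (with $m\le n$ integers) set $p(c)=\sum_{i=m}^n s_ic^i\in L_{\mathbb{B}}(E)$. *)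

(* Defs.v *)
From HB Require Import structures.
From Stdlib Require Import RelationClasses.
From mathcomp Require Import all_boot all_order all_algebra.
From mathcomp Require Import finmap.
From mathcomp Require Import boolp classical_sets functions cardinality fsbigop.

Set Implicit Arguments.
Unset Strict Implicit.
Unset Printing Implicit Defensive.

Import GRing.Theory.

Local Open Scope quotient_scope.
Local Open Scope fset_scope.
Local Open Scope ring_scope.

(* An alias of [bool], because [bool] itself carries the ring structure of the
   field with two elements, whose addition is exclusive or. *)
Definition boolSF_sort : Type := bool.

HB.instance Definition _ := Choice.on boolSF_sort.
HB.instance Definition _ := GRing.isNmodule.Build boolSF_sort orbA orbC orFb.
HB.instance Definition _ := GRing.Nmodule_isComNzSemiRing.Build boolSF_sort
  andbA andbC andTb andb_orl andFb isT.

Definition boolSF : comNzSemiRingType := GRing.ComNzSemiRing.clone boolSF_sort _.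

HB.mixin Record LSemiModule_isBAlg A of GRing.LSemiModule boolSF A := {
  bmul : A -> A -> A;
  bmulA : associative bmul;
  bmulDl : left_distributive bmul +%R;
  bmulDr : right_distributive bmul +%R;
  bscaleAl : forall (k : boolSF) (a b : A), k *: bmul a b = bmul (k *: a) b;
  bscaleAr : forall (k : boolSF) (a b : A), k *: bmul a b = bmul a (k *: b)
}.

#[short(type="bAlgType")]
HB.structure Definition BAlg :=
  {A of LSemiModule_isBAlg A & GRing.LSemiModule boolSF A}.

Notation "a ** b" := (bmul a b) (at level 40, left associativity) : ring_scope.

Record congruence (A : bAlgType) (rho : A -> A -> Prop) : Prop := {
  congruence_equiv : Equivalence rho;
  congruenceD : forall a b s, rho a b -> rho (s + a) (s + b);
  congruenceMl : forall a b s, rho a b -> rho (s ** a) (s ** b);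
  congruenceMr : forall a b s, rho a b -> rho (a ** s) (b ** s)
}.

Definition gen_congruence (A : bAlgType) (R : A -> A -> Prop) : A -> A -> Prop :=
  fun a b => forall rho : A -> A -> Prop, congruence rho ->
    (forall x y, R x y -> rho x y) -> rho a b.

Lemma gen_congruenceP (A : bAlgType) (R : A -> A -> Prop) :
  congruence (gen_congruence R).
Proof.
split; [split| | |].
- by move=> a rho [[h _ _] _ _ _] _; apply: h.
- move=> a b ab rho rhoC Rrho; have [[_ h _] _ _ _] := rhoC.
  by apply: h; apply: ab.
- move=> a b c ab bc rho rhoC Rrho; have [[_ _ h] _ _ _] := rhoC.
  by apply: (h _ b); [apply: ab | apply: bc].
- by move=> a b s ab rho rhoC Rrho; apply: (congruenceD rhoC); apply: ab.
- by move=> a b s ab rho rhoC Rrho; apply: (congruenceMl rhoC); apply: ab.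
- by move=> a b s ab rho rhoC Rrho; apply: (congruenceMr rhoC); apply: ab.
Qed.

Section Quotient.
Variables (A : bAlgType) (rho : A -> A -> Prop) (rhoC : congruence rho).

Definition congb : rel A := fun a b => `[< rho a b >].

Lemma congb_refl : reflexive congb.
Proof. by case: (congruence_equiv rhoC) => h _ _ a; apply/asboolP; apply: h. Qed.

Lemma congb_sym : symmetric congb.
Proof.
case: (congruence_equiv rhoC) => _ h _ a b.
by apply/asboolP/asboolP; apply: h.
Qed.

Lemma congb_trans : transitive congb.
Proof.
case: (congruence_equiv rhoC) => _ _ h b a c /asboolP ab /asboolP bc.
by apply/asboolP; apply: h ab bc.
Qed.

Definition congb_equiv : equiv_rel A :=
  EquivRel congb congb_refl congb_sym congb_trans.

Definition bquot : Type := {eq_quot congb_equiv}.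
HB.instance Definition _ := Choice.on bquot.

Definition to_bquot (a : A) : bquot := \pi_{eq_quot congb_equiv} a.

Definition of_bquot (x : bquot) : A := repr (x : {eq_quot congb_equiv}).

Lemma of_bquotK : cancel of_bquot to_bquot.
Proof. exact: reprK. Qed.

Lemma to_bquotP a b : to_bquot a = to_bquot b <-> rho a b.
Proof.
split=> [/eqquotP/asboolP //|ab].
by apply/eqquotP/asboolP.
Qed.

Definition bquot_add (x y : bquot) := to_bquot (of_bquot x + of_bquot y).
Definition bquot_mul (x y : bquot) := to_bquot (of_bquot x ** of_bquot y).
Definition bquot_scale (k : boolSF) (x : bquot) := to_bquot (k *: of_bquot x).

Lemma of_to_bquot a : rho (of_bquot (to_bquot a)) a.
Proof. by apply/to_bquotP; rewrite of_bquotK. Qed.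

Lemma to_bquotD a b : bquot_add (to_bquot a) (to_bquot b) = to_bquot (a + b).
Proof.
case: (congruence_equiv rhoC) => _ _ tr; apply/to_bquotP.
apply: (tr _ (of_bquot (to_bquot a) + b)).
  by apply: (congruenceD rhoC); apply: of_to_bquot.
rewrite ![_ + b]addrC; apply: (congruenceD rhoC); exact: of_to_bquot.
Qed.

Lemma to_bquotM a b : bquot_mul (to_bquot a) (to_bquot b) = to_bquot (a ** b).
Proof.
case: (congruence_equiv rhoC) => _ _ tr; apply/to_bquotP.
apply: (tr _ (of_bquot (to_bquot a) ** b)).
  by apply: (congruenceMl rhoC); apply: of_to_bquot.
by apply: (congruenceMr rhoC); apply: of_to_bquot.
Qed.

Lemma to_bquotZ k a : bquot_scale k (to_bquot a) = to_bquot (k *: a).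
Proof.
case: (congruence_equiv rhoC) => rf _ _; apply/to_bquotP.
case: k; first by rewrite !scale1r; apply: of_to_bquot.
by rewrite !scale0r; apply: rf.
Qed.

Lemma bquot_addA : associative bquot_add.
Proof.
move=> x y z; rewrite -(of_bquotK x) -(of_bquotK y) -(of_bquotK z).
by rewrite !to_bquotD addrA.
Qed.

Lemma bquot_addC : commutative bquot_add.
Proof. by move=> x y; rewrite /bquot_add addrC. Qed.

Lemma bquot_add0 : left_id (to_bquot 0) bquot_add.
Proof. by move=> x; rewrite -(of_bquotK x) to_bquotD add0r. Qed.

HB.instance Definition _ :=
  GRing.isNmodule.Build bquot bquot_addA bquot_addC bquot_add0.

Lemma bquot_scaleA k l x : bquot_scale k (bquot_scale l x) = bquot_scale (k * l) x.
Proof. by rewrite -(of_bquotK x) !to_bquotZ scalerA. Qed.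

Lemma bquot_scale0 x : bquot_scale 0 x = 0.
Proof. by rewrite -(of_bquotK x) to_bquotZ scale0r. Qed.

Lemma bquot_scale1 : left_id 1 bquot_scale.
Proof. by move=> x; rewrite -(of_bquotK x) to_bquotZ scale1r. Qed.

Lemma bquot_scaleDr : right_distributive bquot_scale +%R.
Proof.
move=> k x y; rewrite -(of_bquotK x) -(of_bquotK y).
by rewrite [_ + _]to_bquotD !to_bquotZ scalerDr [RHS]to_bquotD.
Qed.

Lemma bquot_scaleDl x : {morph bquot_scale^~ x : k l / k + l}.
Proof.
by move=> k l; rewrite -(of_bquotK x) !to_bquotZ scalerDl [RHS]to_bquotD.
Qed.

HB.instance Definition _ := GRing.Nmodule_isLSemiModule.Build boolSF bquot
  bquot_scaleA bquot_scale0 bquot_scale1 bquot_scaleDr bquot_scaleDl.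

Lemma bquot_mulA : associative bquot_mul.
Proof.
move=> x y z; rewrite -(of_bquotK x) -(of_bquotK y) -(of_bquotK z).
by rewrite !to_bquotM bmulA.
Qed.

Lemma bquot_mulDl : left_distributive bquot_mul +%R.
Proof.
move=> x y z; rewrite -(of_bquotK x) -(of_bquotK y) -(of_bquotK z).
by rewrite [_ + _]to_bquotD !to_bquotM bmulDl [RHS]to_bquotD.
Qed.

Lemma bquot_mulDr : right_distributive bquot_mul +%R.
Proof.
move=> x y z; rewrite -(of_bquotK x) -(of_bquotK y) -(of_bquotK z).
by rewrite [_ + _]to_bquotD !to_bquotM bmulDr [RHS]to_bquotD.
Qed.

Lemma bquot_scaleAl (k : boolSF) (x y : bquot) :
  k *: bquot_mul x y = bquot_mul (k *: x) y.
Proof.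
have Z l a : l *: to_bquot a = to_bquot (l *: a) by apply: to_bquotZ.
by rewrite -(of_bquotK x) -(of_bquotK y) Z !to_bquotM Z bscaleAl.
Qed.

Lemma bquot_scaleAr (k : boolSF) (x y : bquot) :
  k *: bquot_mul x y = bquot_mul x (k *: y).
Proof.
have Z l a : l *: to_bquot a = to_bquot (l *: a) by apply: to_bquotZ.
by rewrite -(of_bquotK x) -(of_bquotK y) Z !to_bquotM Z bscaleAr.
Qed.

HB.instance Definition _ := LSemiModule_isBAlg.Build bquot
  bquot_mulA bquot_mulDl bquot_mulDr bquot_scaleAl bquot_scaleAr.

End Quotient.

Section Free.
Variable X : choiceType.

(* [(x, w)] is the nonempty word with first letter [x] and tail [w]: the free
   algebra has no unit. *)
Definition word : Type := (X * seq X)%type.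
HB.instance Definition _ := Choice.on word.

Definition word_cat (u w : word) : word := (u.1, u.2 ++ w.1 :: w.2).

Lemma word_catA : associative word_cat.
Proof. by move=> [x u] [y v] [z w]; rewrite /word_cat /= -catA. Qed.

(* The free semimodule on the words: a finitely supported family of coefficients
   in the Boolean semifield is the finite set of the words with coefficient 1. *)
Definition free_balg : Type := {fset word}.
HB.instance Definition _ := Choice.on free_balg.

Definition free_add (a b : free_balg) : free_balg := a `|` b.
Definition free_scale (k : boolSF) (a : free_balg) : free_balg :=
  if k then a else fset0.
Definition free_mul (a b : free_balg) : free_balg :=
  [fset word_cat u w | u in a, w in b].

Lemma free_addA : associative free_add. Proof. exact: fsetUA. Qed.
Lemma free_addC : commutative free_add. Proof. exact: fsetUC. Qed.
Lemma free_add0 : left_id (fset0 : free_balg) free_add. Proof. exact: fset0U. Qed.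

HB.instance Definition _ :=
  GRing.isNmodule.Build free_balg free_addA free_addC free_add0.

Lemma free_scaleA k l a : free_scale k (free_scale l a) = free_scale (k * l) a.
Proof. by case: k; case: l. Qed.

Lemma free_scale0 a : free_scale 0 a = 0.
Proof. by []. Qed.

Lemma free_scale1 : left_id 1 free_scale.
Proof. by []. Qed.

Lemma free_scaleDr : right_distributive free_scale +%R.
Proof. by case=> a b //=; rewrite [RHS]fsetU0. Qed.

Lemma free_scaleDl a : {morph free_scale^~ a : k l / k + l}.
Proof.
by case; case; rewrite /= ?[RHS]fsetUid ?[RHS]fsetU0 ?[RHS]fset0U.
Qed.

HB.instance Definition _ := GRing.Nmodule_isLSemiModule.Build boolSF free_balg
  free_scaleA free_scale0 free_scale1 free_scaleDr free_scaleDl.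

Lemma in_free_mul (a b : free_balg) (t : word) :
  reflect (exists u w, [/\ u \in a, w \in b & t = word_cat u w])
          (t \in free_mul a b).
Proof.
apply: (iffP idP) => [/imfset2P [u ua [w wb ->]]|[u [w [ua wb ->]]]].
  by exists u, w.
by apply/imfset2P; exists u => //; exists w.
Qed.

Lemma free_mulA : associative free_mul.
Proof.
move=> a b c; apply/fsetP => t; apply/in_free_mul/in_free_mul.
  move=> [u [w [ua /in_free_mul [v [z [vb zc ->]]] ->]]].
  exists (word_cat u v), z; rewrite word_catA; split => //.
  by apply/in_free_mul; exists u, v.
move=> [u [w [/in_free_mul [v [z [va zb ->]]] wc ->]]].
exists v, (word_cat z w); rewrite word_catA; split => //.
by apply/in_free_mul; exists z, w.
Qed.

Lemma free_mulDl : left_distributive free_mul +%R.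
Proof.
move=> a b c; apply/fsetP => t; apply/in_free_mul/idP.
  move=> [u [w [/fsetUP [ua|ub] wc ->]]]; apply/fsetUP; [left|right];
  by apply/in_free_mul; exists u, w.
move=> /fsetUP [] /in_free_mul [u [w [ua wc ->]]]; exists u, w; split => //;
  by apply/fsetUP; [left + right].
Qed.

Lemma free_mulDr : right_distributive free_mul +%R.
Proof.
move=> a b c; apply/fsetP => t; apply/in_free_mul/idP.
  move=> [u [w [ua /fsetUP [wb|wc] ->]]]; apply/fsetUP; [left|right];
  by apply/in_free_mul; exists u, w.
move=> /fsetUP [] /in_free_mul [u [w [ua wc ->]]]; exists u, w; split => //;
  by apply/fsetUP; [left + right].
Qed.

Lemma free_scaleAl (k : boolSF) (a b : free_balg) :
  k *: free_mul a b = free_mul (k *: a) b.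
Proof.
case: k => //; apply/fsetP => t; apply/esym/in_free_mul.
by move=> [u [w []]].
Qed.

Lemma free_scaleAr (k : boolSF) (a b : free_balg) :
  k *: free_mul a b = free_mul a (k *: b).
Proof.
case: k => //; apply/fsetP => t; apply/esym/in_free_mul.
by move=> [u [w []]].
Qed.

HB.instance Definition _ := LSemiModule_isBAlg.Build free_balg
  free_mulA free_mulDl free_mulDr free_scaleAl free_scaleAr.

Definition free_gen (x : X) : free_balg := [fset ((x, [::]) : word)].

End Free.

Record digraph := Digraph {
  vertex : choiceType;
  edge : choiceType;
  src : edge -> vertex;
  tgt : edge -> vertex
}.

Section Graph.
Variable E : digraph.
Implicit Types (v : vertex E) (e f : edge E) (c p : seq (edge E)).

Definition emit v : set (edge E) := [set e | src e = v]%classic.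

Definition row_finite : Prop := forall v, finite_set (emit v).

Definition regular v : Prop := finite_set (emit v) /\ (emit v !=set0)%classic.

Definition is_path p : bool := sorted (fun e f => tgt e == src f) p.

Definition is_cycle v c : bool :=
  if c is e :: c' then
    [&& is_path c, src e == v, tgt (last e c') == v & uniq (map (@src E) c)]
  else false.

Definition is_exit c f : Prop :=
  exists e, [/\ e \in c, src f = src e & f <> e].

(* The summands are the vertices [v], the edges [e] and the symbols [e^*]. *)
Definition lpa_gen : choiceType := (vertex E + edge E + edge E)%type.

Definition gen_v v : free_balg lpa_gen := free_gen (inl (inl v) : lpa_gen).
Definition gen_e e : free_balg lpa_gen := free_gen (inl (inr e) : lpa_gen).
Definition gen_g e : free_balg lpa_gen := free_gen (inr e : lpa_gen).

Inductive lpa_rel : free_balg lpa_gen -> free_balg lpa_gen -> Prop :=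
| lpa_rel_vv v w : lpa_rel (gen_v v ** gen_v w) (if v == w then gen_v v else 0)
| lpa_rel_se e : lpa_rel (gen_v (src e) ** gen_e e) (gen_e e)
| lpa_rel_et e : lpa_rel (gen_e e ** gen_v (tgt e)) (gen_e e)
| lpa_rel_tg e : lpa_rel (gen_v (tgt e) ** gen_g e) (gen_g e)
| lpa_rel_gs e : lpa_rel (gen_g e ** gen_v (src e)) (gen_g e)
| lpa_rel_ge e f :
    lpa_rel (gen_g e ** gen_e f) (if e == f then gen_v (tgt e) else 0)
| lpa_rel_reg v : regular v ->
    lpa_rel (gen_v v) (\sum_(e \in emit v) gen_e e ** gen_g e).

Definition lpa : Type := bquot (gen_congruenceP lpa_rel).
HB.instance Definition _ := BAlg.on lpa.

Definition lpa_v v : lpa := to_bquot (gen_congruenceP lpa_rel) (gen_v v).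
Definition lpa_e e : lpa := to_bquot (gen_congruenceP lpa_rel) (gen_e e).
Definition lpa_g e : lpa := to_bquot (gen_congruenceP lpa_rel) (gen_g e).

(* The path [p] starting at [v], as an element of [lpa]; [v] only matters when
   [p] has length 0. *)
Definition lpa_path v p : lpa :=
  if p is e :: p' then foldl (@bmul lpa) (lpa_e e) (map lpa_e p') else lpa_v v.

(* [p^* = e_n^* ... e_1^*] for [p = e_1 ... e_n] *)
Definition lpa_ghost v p : lpa :=
  if rev p is e :: p' then foldl (@bmul lpa) (lpa_g e) (map lpa_g p')
  else lpa_v v.

(* [iterop n op x idx] is [idx] for [n = 0] and the product of [n] copies of [x]
   otherwise; [Negz n] is [- n.+1]. *)
Definition cycle_pow v c (i : int) : lpa :=
  match i with
  | Posz n => iterop n (@bmul lpa) (lpa_path v c) (lpa_v v)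
  | Negz n => iterop n.+1 (@bmul lpa) (lpa_ghost v c) (lpa_v v)
  end.

End Graph.

Arguments row_finite : clear implicits.
Arguments lpa : clear implicits.

(* [p i] is the coefficient of [x^i]. *)
Definition laurent : Type := {fsfun int -> boolSF with 0}.

Definition laurent_eval (E : digraph) (v : vertex E) (c : seq (edge E))
    (p : laurent) : lpa E :=
  \sum_(i <- finsupp p) (p i : boolSF) *: cycle_pow v c i.

(* Main.v *)
Require Import Defs.
From mathcomp Require Import all_boot all_algebra finmap.
From mathcomp Require Import zify.
From mathcomp Require Import boolp classical_sets cardinality fsbigop.

(** Why the theorem holds.  Every element of the algebra is a finite sum of
    elements [p q^*]; multiplying it on the right by a path [q] that is long
    enough, or that ends at a sink, cancels all ghost edges and leaves a sum of
    genuine paths ([mul_long_path]).  Such paths still separate elements: if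
    [a <> b], the relation [v = \sum e e^*] at regular vertices allows a
    separating path to be prolonged until it stops at a sink or has any
    prescribed length ([separating_path]).  So a non-diagonal pair yields a
    related pair of sums of paths with a common end [w], and some path [p]
    occurs in only one of the two sums.  Multiplying on the left by [p^*] gives
    a related pair [w + x], [y], where [x] and [y] are sums of nonempty loops at
    [w] and of their ghosts ([vertex_plus_loops_related]).

    For a path [m] from [w] and a loop [t] at [w], [m^* t m] vanishes unless [m]
    is a prefix of [t m].  If every path from [w] can be prolonged to a vertex
    that does not emit exactly one edge, then [m] can be led away from the
    finitely many loops in [x] and [y] one after the other ([avoiding_path]);
    conjugation by [m] then relates the end of [m] to 0.

    Otherwise, some path [m] ends at a vertex [u] from which paths never
    branch.  Conjugation by [m] moves the pair to [u].  If there is no loop at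
    [u], then [u] is related to 0.  Otherwise, a shortest loop [c] at [u] is a
    cycle without exits and all loops at [u] are its powers, so the pair becomes
    [p(c)], [q(c)] with [p] of constant coefficient 1 and [q] of constant
    coefficient 0 ([linear_conclusion]). *)

Set Implicit Arguments.
Unset Strict Implicit.
Unset Printing Implicit Defensive.

Import GRing.Theory.
Local Open Scope ring_scope.

(** * Sums and products in Boolean algebras *)

Section BooleanAlgebra.
Variable A : bAlgType.
Implicit Types a b c : A.

Lemma bmul0l b : 0 ** b = 0.
Proof. by have := bscaleAl 0 (0 : A) b; rewrite !scale0r => <-. Qed.

Lemma bmul0r b : b ** 0 = 0.
Proof. by have := bscaleAr 0 b (0 : A); rewrite !scale0r => <-. Qed.

Lemma addbb : idempotent_op (+%R : A -> A -> A).
Proof. by move=> a; have /esym := scalerDl a (1 : boolSF) 1; rewrite !scale1r. Qed.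

Lemma bmul_suml I (s : seq I) (F : I -> A) b :
  (\sum_(i <- s) F i) ** b = \sum_(i <- s) F i ** b.
Proof.
elim: s => [|i s IHs]; first by rewrite !big_nil bmul0l.
by rewrite !big_cons bmulDl IHs.
Qed.

Lemma bmul_sumr I (s : seq I) (F : I -> A) b :
  b ** (\sum_(i <- s) F i) = \sum_(i <- s) b ** F i.
Proof.
elim: s => [|i s IHs]; first by rewrite !big_nil bmul0r.
by rewrite !big_cons bmulDr IHs.
Qed.

(** Addition is idempotent, so a sum depends only on the set of its terms: two
    different sums have a term that occurs in only one of them. *)
Lemma sum_eq_mem (I : eqType) (s t : seq I) (F : I -> A) :
  s =i t -> \sum_(i <- s) F i = \sum_(i <- t) F i.
Proof. by move=> st; apply: eq_big_idem st; apply: addbb. Qed.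

Lemma sum_delta (I : eqType) (s : seq I) (j : I) a :
  j \in s -> \sum_(i <- s) (if i == j then a else 0) = a.
Proof.
move=> js; rewrite -(sum_eq_mem _ (mem_undup s)).
rewrite (bigD1_seq j) ?mem_undup ?undup_uniq //= eqxx big1 ?addr0 // => i.
by case: eqP.
Qed.

(** The scalars are 0 and 1, so these sums are the semimodule generated by [S].
    A list of summands, and not a closure property, is recorded so that the
    summands of two elements can be compared. *)
Definition span (S : A -> Prop) a : Prop :=
  exists s : seq A, (forall b, b \in s -> S b) /\ a = \sum_(b <- s) b.

Lemma span0 (S : A -> Prop) : span S 0.
Proof. by exists [::]; rewrite big_nil. Qed.

Lemma span1 (S : A -> Prop) a : S a -> span S a.
Proof. by exists [:: a]; rewrite big_seq1; split=> // b /[!inE] /eqP ->. Qed.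

Lemma spanD (S : A -> Prop) a b : span S a -> span S b -> span S (a + b).
Proof.
move=> [s [sS ->]] [t [tS ->]]; exists (s ++ t); rewrite big_cat; split=> // c.
by rewrite mem_cat => /orP[/sS|/tS].
Qed.

Lemma span_ind (S P : A -> Prop) :
  P 0 -> (forall a b, P a -> P b -> P (a + b)) -> (forall a, S a -> P a) ->
  forall a, span S a -> P a.
Proof.
move=> P0 PD PS _ [s [sS ->]]; rewrite big_seq.
by apply: big_ind => // b /sS /PS.
Qed.

Lemma span_sandwich (S T : A -> Prop) c c' :
  (forall a, S a -> span T (c ** a ** c')) ->
  forall a, span S a -> span T (c ** a ** c').
Proof.
move=> ST; apply: span_ind => //.
- by rewrite bmul0r bmul0l; apply: span0.
- by move=> a b Ta Tb; rewrite bmulDr bmulDl; apply: spanD.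
Qed.

Lemma span_mull (S T : A -> Prop) c : (forall a, S a -> span T (c ** a)) ->
  forall a, span S a -> span T (c ** a).
Proof.
move=> ST; apply: span_ind => //.
- by rewrite bmul0r; apply: span0.
- by move=> a b Ta Tb; rewrite bmulDr; apply: spanD.
Qed.

Variables (rho : A -> A -> Prop) (rhoC : congruence rho).

Lemma congruence_sym a b : rho a b -> rho b a.
Proof. by case: (congruence_equiv rhoC) => _ h _; apply: h. Qed.

Lemma congruence_sandwich a b c c' : rho a b -> rho (c ** a ** c') (c ** b ** c').
Proof. by move=> ab; apply: congruenceMr => //; apply: congruenceMl. Qed.

End BooleanAlgebra.

Lemma not_uniq_mapP (A B : eqType) (h : A -> B) (s : seq A) :
  ~~ uniq (map h s) -> exists s1 a s2 b s3,
    s = s1 ++ a :: s2 ++ b :: s3 /\ h a = h b.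
Proof.
elim: s => //= a s IHs; rewrite negb_and negbK => /orP[/mapP [b]|/IHs].
  by case/splitPr => s2 s3 hab; exists [::], a, s2, b, s3.
by move=> [s1 [b [s2 [c [s3 [-> hbc]]]]]]; exists (a :: s1), b, s2, c, s3.
Qed.

Section LeavittPathAlgebra.
Variable E : digraph.
Implicit Types (u v w : vertex E) (e f : edge E) (p q t m : seq (edge E)).
Implicit Types (a b x y : lpa E).

(** * Generators and relations *)

Local Notation class := (to_bquot (gen_congruenceP (@lpa_rel E))).

Lemma class_rel g h : lpa_rel g h -> class g = class h.
Proof. by move=> gh; apply/to_bquotP => r _; apply. Qed.

Lemma classM g h : class (g ** h) = (class g : lpa E) ** class h.
Proof. by rewrite [RHS]to_bquotM. Qed.

Lemma classD g h : class (g + h) = (class g : lpa E) + class h.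
Proof. by rewrite [RHS]to_bquotD. Qed.

Lemma lpa_vv v w : lpa_v v ** lpa_v w = if v == w then lpa_v v else 0.
Proof. by rewrite -classM (class_rel (lpa_rel_vv v w)); case: eqP. Qed.

Lemma lpa_src_e e : lpa_v (src e) ** lpa_e e = lpa_e e.
Proof. by rewrite -classM (class_rel (lpa_rel_se e)). Qed.

Lemma lpa_e_tgt e : lpa_e e ** lpa_v (tgt e) = lpa_e e.
Proof. by rewrite -classM (class_rel (lpa_rel_et e)). Qed.

Lemma lpa_tgt_g e : lpa_v (tgt e) ** lpa_g e = lpa_g e.
Proof. by rewrite -classM (class_rel (lpa_rel_tg e)). Qed.

Lemma lpa_g_src e : lpa_g e ** lpa_v (src e) = lpa_g e.
Proof. by rewrite -classM (class_rel (lpa_rel_gs e)). Qed.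

Lemma lpa_ge e f : lpa_g e ** lpa_e f = if e == f then lpa_v (tgt e) else 0.
Proof. by rewrite -classM (class_rel (lpa_rel_ge e f)); case: eqP. Qed.

Lemma lpa_regular v : regular v ->
  lpa_v v = \sum_(e <- fset_set (emit v)) lpa_e e ** lpa_g e.
Proof.
move=> rv; rewrite /lpa_v (class_rel (lpa_rel_reg rv)).
rewrite fsbig_finite; last by case: rv.
have class0 : class 0 = (0 : lpa E) by [].
rewrite (big_morph class classD class0).
by apply: eq_bigr => e _; rewrite classM.
Qed.

(** An element is the class of a finite set of words, hence a sum of products of
    generators. *)
Lemma lpa_gen_ind (P : lpa E -> Prop) :
  P 0 -> (forall a b, P a -> P b -> P (a + b)) ->
  (forall a b, P a -> P b -> P (a ** b)) ->
  (forall v, P (lpa_v v)) -> (forall e, P (lpa_e e)) ->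
  (forall e, P (lpa_g e)) -> forall a, P a.
Proof.
move=> P0 PD PM Pv Pe Pg a; rewrite -(of_bquotK a).
elim/fset1U_rect: (of_bquot a) => [|w s _ Ps]; first exact: P0.
have -> : class (w |` s)%fset = (class [fset w]%fset : lpa E) + class s.
  by rewrite -classD.
apply: PD => //; case: w => g r.
have Pgen h : P (class (free_gen h)) by case: h => [[]|].
elim: r g => [|h r IHr] g; first exact: Pgen.
have -> : class [fset ((g, h :: r) : word (lpa_gen E))]%fset =
    (class (free_gen g) : lpa E) ** class [fset ((h, r) : word (lpa_gen E))]%fset.
  rewrite -classM; congr class; apply/fsetP => z.
  apply/fset1P/in_free_mul => [->|[z1 [z2 [/fset1P -> /fset1P -> //]]]].
  by exists (g, [::]), (h, r); rewrite !inE.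
by apply: PM.
Qed.

(** * Paths, ghost paths and their products *)

(** The source is kept beside the list of edges because an empty list does not
    determine it. *)
Fixpoint path_from v p : bool :=
  if p is e :: p' then (src e == v) && path_from (tgt e) p' else true.

Definition path_end v p : vertex E := last v (map (@tgt E) p).

Lemma path_from_cons v e p :
  path_from v (e :: p) = (src e == v) && path_from (tgt e) p.
Proof. by []. Qed.

Lemma path_end_cons v e p : path_end v (e :: p) = path_end (tgt e) p.
Proof. by []. Qed.

Lemma path_from_cat v p q :
  path_from v (p ++ q) = path_from v p && path_from (path_end v p) q.
Proof. by elim: p v => //= e p IHp v; rewrite IHp andbA. Qed.

Lemma path_end_cat v p q : path_end v (p ++ q) = path_end (path_end v p) q.
Proof. by rewrite /path_end map_cat last_cat. Qed.

Lemma lpa_path_cons v e p :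
  lpa_path v (e :: p) = lpa_e e ** lpa_path (tgt e) p.
Proof.
case: p => [|f p] /=; first by rewrite lpa_e_tgt.
elim: p (lpa_e f) => //= h p IHp x.
by rewrite -bmulA IHp.
Qed.

Lemma lpa_ghost_cons v e p :
  lpa_ghost v (e :: p) = lpa_ghost (tgt e) p ** lpa_g e.
Proof.
rewrite /lpa_ghost rev_cons; case: (rev p) => [|f r] /=.
  by rewrite lpa_tgt_g.
by rewrite map_rcons foldl_rcons.
Qed.

Lemma vertex_path v p : path_from v p -> lpa_v v ** lpa_path v p = lpa_path v p.
Proof.
case: p => [_|e p /andP[/eqP <- _]]; first by rewrite lpa_vv eqxx.
by rewrite lpa_path_cons bmulA lpa_src_e.
Qed.

Lemma ghost_vertex v p : path_from v p -> lpa_ghost v p ** lpa_v v = lpa_ghost v p.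
Proof.
case: p => [_|e p /andP[/eqP <- _]]; first by rewrite lpa_vv eqxx.
by rewrite lpa_ghost_cons -bmulA lpa_g_src.
Qed.

Lemma path_vertex v p : lpa_path v p ** lpa_v (path_end v p) = lpa_path v p.
Proof.
elim: p v => [|e p IHp] v; first by rewrite lpa_vv eqxx.
by rewrite lpa_path_cons -bmulA IHp.
Qed.

Lemma lpa_path_cat v p q : path_from (path_end v p) q ->
  lpa_path v (p ++ q) = lpa_path v p ** lpa_path (path_end v p) q.
Proof.
elim: p v => [|e p IHp] v qP; first by rewrite vertex_path.
by rewrite cat_cons !lpa_path_cons IHp // bmulA.
Qed.

Lemma lpa_ghost_cat v p q : path_from (path_end v p) q ->
  lpa_ghost v (p ++ q) = lpa_ghost (path_end v p) q ** lpa_ghost v p.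
Proof.
elim: p v => [|e p IHp] v qP; first by rewrite ghost_vertex.
by rewrite cat_cons !lpa_ghost_cons IHp // bmulA.
Qed.

Lemma ghost_path_catl v p q : path_from v (p ++ q) ->
  lpa_ghost v p ** lpa_path v (p ++ q) = lpa_path (path_end v p) q.
Proof.
elim: p v => [|e p IHp] v; first exact: vertex_path.
rewrite cat_cons path_from_cons => /andP[_ pP].
rewrite lpa_ghost_cons lpa_path_cons -bmulA (bmulA (lpa_g e)) lpa_ge eqxx.
by rewrite vertex_path // IHp.
Qed.

Lemma ghost_path_catr v p q : path_from v (p ++ q) ->
  lpa_ghost v (p ++ q) ** lpa_path v p = lpa_ghost (path_end v p) q.
Proof.
elim: p v => [|e p IHp] v; first exact: ghost_vertex.
rewrite cat_cons path_from_cons => /andP[_ pP].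
rewrite lpa_ghost_cons lpa_path_cons -bmulA (bmulA (lpa_g e)) lpa_ge eqxx.
rewrite vertex_path ?IHp //.
by move: pP; rewrite path_from_cat => /andP[].
Qed.

(** At the first edge where the two paths disagree, [e^* f = 0]. *)
Lemma ghost_path_eq0 v p w q : path_from v p -> path_from w q ->
  [|| v != w | ~~ prefix p q && ~~ prefix q p] ->
  lpa_ghost v p ** lpa_path w q = 0.
Proof.
elim: p v w q => [|e p IHp] v w q.
  move=> _ qP; rewrite prefix0s orbF => /negPf vw.
  by rewrite -(vertex_path qP) bmulA lpa_vv vw bmul0l.
move=> /andP[/eqP <- pP]; case: q => [|f q].
  rewrite prefix0s andbF orbF => _ /negPf vw.
  by rewrite lpa_ghost_cons -bmulA -(lpa_g_src e) -bmulA lpa_vv vw !bmul0r.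
move=> /andP[/eqP <- qP]; rewrite lpa_ghost_cons lpa_path_cons -bmulA.
rewrite (bmulA (lpa_g e)) lpa_ge !prefix_cons.
case: (eqVneq e f) pP => [->|_] pP; last by rewrite bmul0l bmul0r.
by rewrite vertex_path // eqxx /= => pq; apply: IHp => //; rewrite eqxx.
Qed.

(** * Separating two elements by a long path *)

(** The algebra has no unit when there are infinitely many vertices, but finitely
    many generators occur in [a], and the sum of the vertices where they end
    fixes [a], as does any larger sum by idempotency. *)
Lemma local_unit a : exists V : seq (vertex E), forall W,
  {subset V <= W} -> a ** \sum_(w <- W) lpa_v w = a.
Proof.
have unit1 v b : b ** lpa_v v = b -> exists V : seq (vertex E), forall W,
    {subset V <= W} -> b ** \sum_(w <- W) lpa_v w = b.
  move=> bv; exists [:: v] => W VW; rewrite bmul_sumr -[RHS](@sum_delta _ _ W v).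
    apply: eq_bigr => w _; rewrite -bv -bmulA lpa_vv eq_sym.
    by case: eqP => // _; rewrite bmul0r.
  by apply: VW; rewrite mem_head.
elim/lpa_gen_ind: a => [|a b [V VP] [W WP]|a b _ [W WP]|v|e|e].
- by exists [::] => W _; rewrite bmul0l.
- exists (V ++ W) => U UP; rewrite bmulDl VP ?WP // => v vV; apply: UP.
    by rewrite mem_cat vV orbT.
  by rewrite mem_cat vV.
- by exists W => U UP; rewrite -bmulA WP.
- by apply: (unit1 v); rewrite lpa_vv eqxx.
- by apply: (unit1 (tgt e)); rewrite lpa_e_tgt.
- by apply: (unit1 (src e)); rewrite lpa_g_src.
Qed.

Lemma eq_on_vertices a b : (forall v, a ** lpa_v v = b ** lpa_v v) -> a = b.
Proof.
move=> ab; have [V VP] := local_unit a; have [W WP] := local_unit b.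
rewrite -(VP (V ++ W)) => [|v vV]; last by rewrite mem_cat vV.
rewrite -[RHS](WP (V ++ W)) => [|v vW]; last by rewrite mem_cat vW orbT.
by rewrite !bmul_sumr; apply: eq_bigr => v _.
Qed.

Definition sink v : Prop := forall e, src e <> v.

(** These are the paths that no ghost path with at most [n] edges can outlast:
    a path ending at a sink cannot be a proper prefix of another path. *)
Definition long n v q : Prop := (n <= size q)%N \/ sink (path_end v q).

Lemma long_le n n' v q : (n' <= n)%N -> long n v q -> long n' v q.
Proof. by move=> n'n [/(leq_trans n'n)|]; [left|right]. Qed.

(** A separating path [q] ending at a regular vertex [u] has a separating
    extension by one edge, since [c q = \sum c (q e) e^*] by the relation that
    expands [u] as a sum over the edges it emits. *)
Lemma separating_path (hE : row_finite E) a b n : a <> b ->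
  exists v q, [/\ path_from v q, long n v q &
                  a ** lpa_path v q <> b ** lpa_path v q].
Proof.
move=> ab; elim: n => [|n [v [q [vq long_q abq]]]].
  have /existsNP [v abv] : ~ forall v, a ** lpa_v v = b ** lpa_v v.
    by move/eq_on_vertices.
  by exists v, [::]; split=> //; left.
have [sink_q|nsink_q] := pselect (sink (path_end v q)).
  by exists v, q; split=> //; right.
have size_q : (n <= size q)%N by case: long_q.
set u := path_end v q in nsink_q.
have reg_u : regular u.
  by split=> //; case/existsNP: nsink_q => e /contrapT eu; exists e.
have /existsNP [e] : ~ forall e, src e = u ->
    a ** lpa_path v (rcons q e) = b ** lpa_path v (rcons q e).
  move=> abe; apply: abq.
  suff expand c : c ** lpa_path v q = \sum_(e <- fset_set (emit u))
      (if src e == u then c ** lpa_path v (rcons q e) ** lpa_g e else 0).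
    rewrite !expand; apply: eq_bigr => e _.
    by case: eqP => // /abe ->.
  rewrite -path_vertex -/u (lpa_regular reg_u) !bmul_sumr !big_seq.
  apply: eq_bigr => e; rewrite in_fset_set; last by case: reg_u.
  rewrite inE /emit /= => /eqP eu; rewrite eu -cats1 lpa_path_cat /= ?eu //.
  by rewrite !bmulA.
move=> /not_implyP [eu abe]; exists v, (rcons q e); split=> //.
  by rewrite -cats1 path_from_cat vq /= -/u eu eqxx.
by left; rewrite size_rcons.
Qed.

(** The lower bound on the length is what lets a second factor act after a first
    one in [mul_long_path]. *)
Definition real_path w n a : Prop := exists v p,
  [/\ path_from v p, path_end v p = w, (n <= size p)%N & a = lpa_path v p].

Lemma span_real_pathS w n n' a : (n' <= n)%N ->
  span (real_path w n) a -> span (real_path w n') a.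
Proof.
move=> n'n [s [sP ->]]; exists s; split=> // b /sP [v [p [vp wp np ->]]].
by exists v, p; split=> //; apply: leq_trans np.
Qed.

(** Each ghost edge in [a] cancels one edge of a long path, or kills it.  The
    product may shorten the path, but only by a bounded number [M] of edges, so
    a longer initial path leaves enough edges for the next factor. *)
Lemma mul_long_path a : exists N M, forall v q, path_from v q -> long N v q ->
  span (real_path (path_end v q) (size q - M)) (a ** lpa_path v q).
Proof.
elim/lpa_gen_ind: a =>
  [|a b [Na [Ma aP]] [Nb [Mb bP]]|a b [Na [Ma aP]] [Nb [Mb bP]]|w|e|e].
- by exists 0%N, 0%N => v q _ _; rewrite bmul0l; apply: span0.
- exists (maxn Na Nb), (maxn Ma Mb) => v q vq lq; rewrite bmulDl; apply: spanD.
    apply: (span_real_pathS (n := size q - Ma)).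
      by rewrite leq_sub2l // leq_maxl.
    by apply: aP => //; apply: long_le lq; apply: leq_maxl.
  apply: (span_real_pathS (n := size q - Mb)).
    by rewrite leq_sub2l // leq_maxr.
  by apply: bP => //; apply: long_le lq; apply: leq_maxr.
- exists (maxn Nb (Mb + Na)), (Ma + Mb)%N => v q vq lq; rewrite -bmulA.
  have lqb : long Nb v q by apply: long_le lq; apply: leq_maxl.
  apply: span_mull (bP v q vq lqb) => _ [u [p [up pq sp ->]]].
  apply: (span_real_pathS (n := size p - Ma)).
    by rewrite addnC subnDA leq_sub2r.
  rewrite -pq; apply: aP => //; case: lq => [|sq]; last by right; rewrite pq.
  rewrite geq_max => /andP[_ lq]; left; apply: leq_trans sp.
  by rewrite leq_subRL // (leq_trans _ lq) // leq_addr.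
- exists 0%N, 0%N => v q vq _; rewrite -(vertex_path vq) bmulA lpa_vv.
  case: eqP => [->|_]; last by rewrite bmul0l; apply: span0.
  by rewrite vertex_path //; apply: span1; exists v, q; rewrite subn0.
- exists 0%N, 0%N => v q vq _; rewrite -(lpa_e_tgt e) -bmulA.
  rewrite -(vertex_path vq) bmulA bmulA -(bmulA (lpa_e e)) lpa_vv.
  case: eqP => [ev|_]; last by rewrite bmul0r bmul0l; apply: span0.
  rewrite lpa_e_tgt; apply: span1; exists (src e), (e :: q).
  by rewrite lpa_path_cons path_from_cons eqxx ev subn0 -{2}ev; split=> //=.
- (* With [N = 1], an empty path is allowed only at a sink, where no edge can
     start. *)
  exists 1%N, 1%N => v [|f q].
    move=> _ [//|sink_v]; rewrite -(lpa_g_src e) /= -bmulA lpa_vv.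
    by case: eqP => [/sink_v//|_]; rewrite bmul0r; apply: span0.
  move=> /andP[/eqP fv fq] _; rewrite lpa_path_cons bmulA lpa_ge.
  case: eqP => [->|_]; last by rewrite bmul0l; apply: span0.
  rewrite vertex_path //; apply: span1; exists (tgt f), q; split=> //=.
  by rewrite subn1.
Qed.

(** * Reduction to loops at a vertex *)

Definition loop w t : bool :=
  [&& t != [::], path_from w t & path_end w t == w].

Definition loop_elt w a : Prop :=
  exists2 t, loop w t & a = lpa_path w t \/ a = lpa_ghost w t.

(** For different paths with the same end, either they disagree at some edge and
    the product is 0, or one is a prefix of the other and what remains is a
    nonempty loop. *)
Lemma ghost_path_loop v p v' p' w :
  path_from v p -> path_end v p = w -> path_from v' p' -> path_end v' p' = w ->
  lpa_path v p <> lpa_path v' p' ->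
  span (loop_elt w) (lpa_ghost v p ** lpa_path v' p').
Proof.
move=> vp pw vp' pw' neq.
case: (boolP [|| v != v' | ~~ prefix p p' && ~~ prefix p' p]) => [|].
  by move=> /ghost_path_eq0 -> //; apply: span0.
rewrite negb_or negbK negb_and !negbK => /andP[/eqP vv']; subst v'.
have loopP q t : path_end v q = w -> path_from v (q ++ t) ->
    path_end v (q ++ t) = w -> lpa_path v q <> lpa_path v (q ++ t) -> loop w t.
  move=> qw; rewrite path_from_cat path_end_cat qw => /andP[_ wt] tw.
  by rewrite /loop wt tw eqxx andbT; case: t {wt tw} => //; rewrite cats0.
move=> /orP[] /prefixP [t tE]; rewrite {}tE in vp vp' pw pw' neq *.
  rewrite ghost_path_catl // pw; apply: span1; exists t; last by left.
  exact: (loopP p).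
rewrite ghost_path_catr // pw'; apply: span1; exists t; last by right.
by apply: (loopP p') => // /esym.
Qed.

(** With [p] a path that occurs in only one of two related sums of paths ending
    at [w], multiplication by [p^*] turns [p] into [w] and every other term into
    a nonempty loop, the ghost of one, or 0. *)
Lemma vertex_plus_loops_related (hE : row_finite E)
    (rho : lpa E -> lpa E -> Prop) (rhoC : congruence rho)
    (hdiag : ~ (forall a b, rho a b <-> a = b)) :
  exists w x y, [/\ span (loop_elt w) x, span (loop_elt w) y &
                    rho (lpa_v w + x) y].
Proof.
have [a [b [ab nab]]] : exists a b, rho a b /\ a <> b.
  apply: contrapT => H; apply: hdiag => a b; split=> [ab|->].
    by apply: contrapT => nab; apply: H; exists a, b.
  by case: (congruence_equiv rhoC).
have [Na [Ma aP]] := mul_long_path a; have [Nb [Mb bP]] := mul_long_path b.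
have [v [q [vq lq abq]]] := separating_path hE (maxn Na Nb) nab.
set w := path_end v q.
have [s [sP aqE]] : span (real_path w (size q - Ma)) (a ** lpa_path v q).
  by apply: aP => //; apply: long_le lq; apply: leq_maxl.
have [s' [sP' bqE]] : span (real_path w (size q - Mb)) (b ** lpa_path v q).
  by apply: bP => //; apply: long_le lq; apply: leq_maxr.
have {}ab : rho (\sum_(c <- s) c) (\sum_(c <- s') c).
  by rewrite -aqE -bqE; apply: congruenceMr.
have {aqE bqE abq} /existsNP [c /eqP cP] : ~ s =i s'.
  by move=> ss'; apply: abq; rewrite aqE bqE; apply: sum_eq_mem.
have {}sP d : d \in s -> real_path w 0 d.
  by move=> /sP [u [p [? ? ? ?]]]; exists u, p.
have {}sP' d : d \in s' -> real_path w 0 d.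
  by move=> /sP' [u [p [? ? ? ?]]]; exists u, p.
move: {aP bP nab lq} cP.
wlog cs : s s' sP sP' ab / c \in s => [hwlog cP|].
  case: (boolP (c \in s)) => [cs|ncs]; first exact: (hwlog s s').
  apply: (hwlog s' s) => //; first exact: congruence_sym ab.
    by move: cP; rewrite (negPf ncs); case: (c \in s').
  by rewrite eq_sym.
rewrite cs eq_sym eqb_id => ncs'.
have [u [p [up pw _ cE]]] := sP c cs.
have loops r : (forall d, d \in r -> real_path w 0 d /\ d <> c) ->
    span (loop_elt w) (lpa_ghost u p ** \sum_(d <- r) d).
  move=> rP; rewrite bmul_sumr big_seq.
  apply: big_ind => [||d /rP [[u' [p' [up' pw' _ ->]]] dc]].
  - exact: span0.
  - exact: spanD.
  - by apply: ghost_path_loop => //; rewrite -cE => /esym.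
exists w, (lpa_ghost u p ** \sum_(d <- filter (predC1 c) s) d),
  (lpa_ghost u p ** \sum_(d <- s') d).
split.
- by apply: loops => d; rewrite mem_filter => /andP[/eqP dc /sP].
- apply: loops => d ds'; split; first exact: sP'.
  by move=> dc; rewrite -dc ds' in ncs'.
have <- : lpa_ghost u p ** c = lpa_v w.
  have := @ghost_path_catl u p [::]; rewrite cats0 cE => -> //=.
  by rewrite pw.
rewrite -bmulDr -(big_cons _ _ c _ xpredT id).
rewrite (@sum_eq_mem _ _ _ s) => [|d]; first exact: congruenceMl.
rewrite inE mem_filter /=; case: eqVneq => [->|//]; by rewrite cs.
Qed.

(** * Conjugating loops by a path *)

Lemma conj_vertex w m : path_from w m ->
  lpa_ghost w m ** lpa_v w ** lpa_path w m = lpa_v (path_end w m).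
Proof.
move=> wm; rewrite ghost_vertex //.
by have := @ghost_path_catl w m [::]; rewrite cats0 => ->.
Qed.

(** In [m^* t m], the ghost [m^*] meets the path [t m], which is longer than
    [m]; so the product vanishes as soon as [m] is not a prefix of [t m].  The
    ghost loop [t^*] is dual. *)
Lemma conj_loop_eq0 w m t a : path_from w m -> loop w t ->
  a = lpa_path w t \/ a = lpa_ghost w t -> ~~ prefix m (t ++ m) ->
  lpa_ghost w m ** a ** lpa_path w m = 0.
Proof.
move=> wm /and3P [t0 wt /eqP tw] aE nm.
have wtm : path_from w (t ++ m) by rewrite path_from_cat wt tw.
have ntm : ~~ prefix (t ++ m) m.
  apply: contra t0 => /prefixP [r /(congr1 size)].
  by rewrite !size_cat -size_eq0; lia.
case: aE => ->.
  rewrite -bmulA -{3}tw -lpa_path_cat ?tw // ghost_path_eq0 //.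
  by rewrite nm ntm orbT.
rewrite -{1}tw -lpa_ghost_cat ?tw // ghost_path_eq0 //.
by rewrite nm ntm orbT.
Qed.

Lemma conj_loop_elt w m a : path_from w m -> loop_elt w a ->
  span (loop_elt (path_end w m)) (lpa_ghost w m ** a ** lpa_path w m).
Proof.
move=> wm [t loop_t aE].
case: (boolP (prefix m (t ++ m))) => [/prefixP [t' tE]|nm]; last first.
  by rewrite (conj_loop_eq0 wm loop_t aE nm); apply: span0.
have /and3P [t0 wt /eqP tw] := loop_t.
have wmt : path_from w (m ++ t') by rewrite -tE path_from_cat wt tw.
apply: span1; exists t'.
  rewrite /loop; move: wmt; rewrite path_from_cat => /andP[_ ->] /=.
  rewrite -path_end_cat -tE path_end_cat tw eqxx andbT.
  apply: contra t0 => /eqP t'0.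
  by move: tE => /(congr1 size); rewrite t'0 cats0 size_cat -size_eq0; lia.
case: aE => ->; [left|right].
  by rewrite -bmulA -{3}tw -lpa_path_cat ?tw // tE ghost_path_catl.
by rewrite -{1}tw -lpa_ghost_cat ?tw // tE ghost_path_catr.
Qed.

(** The vertices where a path can leave a given loop: another edge can be taken,
    or, at a sink, no loop can continue. *)
Definition branching v : Prop :=
  forall e, src e = v -> exists2 f, src f = v & f <> e.

Lemma conj0_extend w m n a : path_from (path_end w m) n ->
  lpa_ghost w m ** a ** lpa_path w m = 0 ->
  lpa_ghost w (m ++ n) ** a ** lpa_path w (m ++ n) = 0.
Proof.
move=> mn a0; rewrite lpa_ghost_cat // lpa_path_cat //.
rewrite bmulA -(bmulA _ _ a) -(bmulA _ (_ ** a)) a0.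
by rewrite bmul0r bmul0l.
Qed.

(** The loops are dealt with one at a time: a prolongation of a path that kills
    a loop still kills it.  If [m], prolonged to a branching vertex, is a prefix
    of [t m], then [t m] tells the next edge, and a different one can be taken. *)
Lemma avoiding_path w (s : seq (lpa E)) :
  (forall a, a \in s -> loop_elt w a) ->
  (forall m, path_from w m -> exists2 n, path_from (path_end w m) n &
     branching (path_end w (m ++ n))) ->
  exists2 m, path_from w m &
    forall a, a \in s -> lpa_ghost w m ** a ** lpa_path w m = 0.
Proof.
move=> sP br; elim: s sP => [|a s IHs] sP; first by exists [::].
have [|m wm m0] := IHs; first by move=> b bs; apply: sP; rewrite inE bs orbT.
suff [n mn a0] : exists2 n, path_from (path_end w m) n &
    lpa_ghost w (m ++ n) ** a ** lpa_path w (m ++ n) = 0.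
  exists (m ++ n); first by rewrite path_from_cat wm.
  move=> b /[!inE] /orP[/eqP -> //|/m0 b0]; exact: conj0_extend.
have [t loop_t aE] := sP a (mem_head a s).
have [n mn br_n] := br m wm.
have wmn : path_from w (m ++ n) by rewrite path_from_cat wm.
case: (boolP (prefix (m ++ n) (t ++ m ++ n))) => [/prefixP [r rE]|np]; last first.
  by exists n => //; apply: conj_loop_eq0 np.
have /and3P [t0 wt /eqP tw] := loop_t.
case: r rE => [/(congr1 size)|e r rE].
  by rewrite cats0 size_cat => sE; move: t0; rewrite -size_eq0; lia.
have src_e : src e = path_end w (m ++ n).
  have : path_from w (t ++ m ++ n) by rewrite path_from_cat wt tw.
  by rewrite rE path_from_cat => /andP[_ /andP[/eqP ->]].
have [f src_f fe] := br_n e src_e.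
have wmnf : path_from w ((m ++ n) ++ [:: f]).
  by rewrite path_from_cat wmn /= src_f eqxx.
exists (n ++ [:: f]); first by move: wmnf; rewrite -catA path_from_cat => /andP[].
rewrite catA; apply: (conj_loop_eq0 wmnf loop_t aE).
rewrite (catA t) rE -(catA (m ++ n) (e :: r)) prefix_catr // eqxx cat_cons prefix_cons.
by case: eqP.
Qed.

(** * Vertices from which paths are unique *)

(** A path from such a vertex is determined by its length. *)
Definition linear_from u : Prop := forall m e f, path_from u m ->
  src e = path_end u m -> src f = path_end u m -> e = f.

Lemma linear_prefix u p q : linear_from u -> path_from u p -> path_from u q ->
  (size p <= size q)%N -> prefix p q.
Proof.
elim: p u q => [|e p IHp] u [|f q] //= lin_u.
move=> /andP[/eqP eu ep] /andP[/eqP fu fq] pq.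
have ef : e = f by apply: (lin_u [::]).
rewrite ef eqxx in ep *; apply: IHp ep fq pq => m g h fm gm hm.
by apply: (lin_u (f :: m)) => //=; rewrite fu eqxx.
Qed.

Lemma minimal_loop u t : loop u t ->
  exists2 c, loop u c & forall t', loop u t' -> (size c <= size t')%N.
Proof.
move=> loop_t.
have ex : exists n, `[< exists2 c, loop u c & size c = n >].
  by exists (size t); apply/asboolP; exists t.
case: (ex_minnP ex) => n /asboolP [c loop_c cn] min_n.
by exists c => // t' loop_t'; rewrite cn; apply: min_n; apply/asboolP; exists t'.
Qed.

(** If two edges of a loop have the same source, the part between them can be cut
    out; the result is still a loop, and it is shorter. *)
Lemma minimal_loop_cycle u c : loop u c ->
  (forall t, loop u t -> (size c <= size t)%N) -> is_cycle u c.
Proof.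
move=> loop_c min_c; have /and3P [c0 uc cu] := loop_c.
have uniq_c : uniq (map (@src E) c).
  apply/negPn/negP => /not_uniq_mapP [s1 [e [s2 [f [s3 [cE ef]]]]]].
  have /min_c : loop u (s1 ++ f :: s3).
    move: uc cu; rewrite /loop cE -size_eq0 size_cat addnS /=.
    rewrite !(path_from_cat, path_from_cons, path_end_cat, path_end_cons) ef.
    by move=> /andP[-> /andP[-> /andP[_ /andP[_ ->]]]] ->.
  by rewrite cE !size_cat /= size_cat /=; lia.
case: c c0 uc cu uniq_c {loop_c min_c} => //= e c _ /andP[-> ec] eu -> /=.
rewrite {1}/path_end /= in eu; rewrite -(last_map (@tgt E)) eu !andbT.
elim: c e ec {eu} => //= f c IHc e /andP[/eqP <- fc].
by rewrite eqxx IHc.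
Qed.

(** Two paths from [u] are comparable for the prefix order, so [c] can be removed
    from the front of any loop at [u], and the rest is again a loop or empty. *)
Lemma linear_loop_power u c t : linear_from u -> loop u c ->
  (forall t', loop u t' -> (size c <= size t')%N) -> loop u t ->
  exists n, t = flatten (nseq n.+1 c).
Proof.
move=> lin_u loop_c min_c; have /and3P [c0 uc /eqP cu] := loop_c.
have [n] := ubnP (size t); elim: n t => // n IHn t tn loop_t.
have /and3P [_ ut tu] := loop_t.
have /prefixP [t' tE] := linear_prefix lin_u uc ut (min_c t loop_t).
have [t'0|t'0] := eqVneq t' [::].
  by exists 0%N; rewrite tE t'0.
have [||k t'E] := IHn t'; last by exists k.+1; rewrite tE t'E.
  move: tn c0; rewrite tE size_cat -size_eq0 -lt0n => tn c0.
  by apply: leq_trans (_ : size c + size t' <= n)%N => //; rewrite -add1n leq_add2r.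
move: ut tu; rewrite tE path_from_cat path_end_cat cu uc /loop t'0.
by move=> /= -> ->.
Qed.

(** * Laurent polynomials in a cycle *)

Lemma path_from_power u c n : path_from u c -> path_end u c = u ->
  path_from u (flatten (nseq n c)).
Proof.
by move=> uc cu; elim: n => //= n IHn; rewrite path_from_cat uc cu.
Qed.

Lemma path_power u c n : path_from u c -> path_end u c = u ->
  lpa_path u (flatten (nseq n c)) =
    iterop n (@bmul (lpa E)) (lpa_path u c) (lpa_v u).
Proof.
move=> uc cu; case: n => // n; rewrite iteropS.
elim: n => [|n IHn]; first by rewrite /= cats0.
have -> : flatten (nseq n.+2 c) = c ++ flatten (nseq n.+1 c) by [].
by rewrite iterS -IHn lpa_path_cat cu ?path_from_power.
Qed.

Lemma ghost_power u c n : path_from u c -> path_end u c = u ->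
  lpa_ghost u (flatten (nseq n c)) =
    iterop n (@bmul (lpa E)) (lpa_ghost u c) (lpa_v u).
Proof.
move=> uc cu; case: n => // n; rewrite iteropS.
elim: n => [|n IHn]; first by rewrite /= cats0.
have -> : flatten (nseq n.+2 c) = c ++ flatten (nseq n.+1 c) by [].
rewrite lpa_ghost_cat cu ?path_from_power // IHn.
by elim: n {IHn} => //= n IHn; rewrite -bmulA IHn.
Qed.

Lemma cycle_sum_laurent v c (I : seq int) : exists p : laurent,
  (forall i, p i = (i \in I)) /\
  laurent_eval v c p = \sum_(i <- I) cycle_pow v c i.
Proof.
pose p : laurent := [fsfun i in [fset i in I]%fset => (1 : boolSF) | 0].
have pE i : p i = (i \in I) by rewrite fsfunE in_fset; case: (i \in I).
exists p; split=> //; rewrite /laurent_eval.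
transitivity (\sum_(i <- finsupp p) cycle_pow v c i).
  apply: eq_big_seq => i; rewrite mem_finsupp.
  case: (p i) => // _; exact: scale1r.
by apply: sum_eq_mem => i; rewrite mem_finsupp pE; case: (i \in I).
Qed.

(** The loops in the span are nonempty, hence nonzero powers of [c]; this keeps
    the exponent 0 apart from the exponents [I]. *)
Lemma loop_span_cycle_sum u c x : linear_from u -> loop u c ->
  (forall t, loop u t -> (size c <= size t)%N) -> span (loop_elt u) x ->
  exists2 I : seq int, 0 \notin I & x = \sum_(i <- I) cycle_pow u c i.
Proof.
move=> lin_u loop_c min_c; have /and3P [_ uc /eqP cu] := loop_c.
move: x; apply: span_ind => [|a b [I I0 ->] [J J0 ->]|a [t loop_t aE]].
- by exists [::] => //; rewrite big_nil.
- by exists (I ++ J); rewrite ?mem_cat ?negb_or ?I0 // big_cat.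
have [n tE] := linear_loop_power lin_u loop_c min_c loop_t.
case: aE => ->.
  exists [:: Posz n.+1] => //; rewrite big_seq1 tE; exact: path_power.
exists [:: Negz n] => //; rewrite big_seq1 tE; exact: ghost_power.
Qed.

(** * Conclusion for a vertex plus loops *)

Variables (rho : lpa E -> lpa E -> Prop) (rhoC : congruence rho).

Definition vertex_or_cycle_collapses : Prop :=
  (exists v, rho (lpa_v v) 0) \/
  (exists v c (p q : laurent),
     [/\ is_cycle v c, (~ exists f, is_exit c f), p <> q &
         rho (laurent_eval v c p) (laurent_eval v c q)]).

(** When there is a loop at [u], the vertex [u] is the term of exponent 0 of the
    left member, and the right member has no such term: this tells the two
    Laurent polynomials apart. *)
Lemma linear_conclusion u x y : linear_from u ->
  span (loop_elt u) x -> span (loop_elt u) y -> rho (lpa_v u + x) y ->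
  vertex_or_cycle_collapses.
Proof.
move=> lin_u xP yP xy.
have [[t loop_t]|noloop] := pselect (exists t, loop u t); last first.
  have span_eq0 z : span (loop_elt u) z -> z = 0.
    move: z; apply: span_ind => // [a b -> ->|a [t loop_t _]]; first exact: addr0.
    by case: noloop; exists t.
  by left; exists u; move: xy; rewrite (span_eq0 x) // (span_eq0 y) // addr0.
right; have [c loop_c min_c] := minimal_loop loop_t.
have [I I0 xE] := loop_span_cycle_sum lin_u loop_c min_c xP.
have [J J0 yE] := loop_span_cycle_sum lin_u loop_c min_c yP.
have [p [pE evalp]] := cycle_sum_laurent u c (0 :: I).
have [q [qE evalq]] := cycle_sum_laurent u c J.
exists u, c, p, q; split.
- exact: minimal_loop_cycle.
- move=> [f [e [ec src_f]]]; apply.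
  have /and3P [_ uc _] := loop_c.
  case/splitPr: ec uc => c1 c2; rewrite path_from_cat path_from_cons.
  move=> /and3P [uc1 /eqP src_e _].
  by apply: (lin_u c1); rewrite ?src_f.
- move=> pq; have := pE 0; rewrite pq qE mem_head => J0'.
  by rewrite J0' in J0.
- by rewrite evalp evalq big_cons -xE -yE.
Qed.

(** Either every path from [w] can be prolonged to a branching vertex, and a path
    avoiding all loops of [x] and [y] exists, or some path from [w] leads to a
    vertex with unique paths.  In both cases the pair is conjugated by that
    path. *)
Lemma dichotomy w x y : span (loop_elt w) x -> span (loop_elt w) y ->
  rho (lpa_v w + x) y -> vertex_or_cycle_collapses.
Proof.
move=> xP yP xy.
have conj_xy m : path_from w m -> rho
    (lpa_v (path_end w m) + lpa_ghost w m ** x ** lpa_path w m)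
    (lpa_ghost w m ** y ** lpa_path w m).
  move=> wm; rewrite -conj_vertex // -bmulDl -bmulDr.
  exact: congruence_sandwich.
have [br|] := pselect (forall m, path_from w m ->
    exists2 n, path_from (path_end w m) n & branching (path_end w (m ++ n))).
  have [s [sP xE]] := xP; have [s' [sP' yE]] := yP.
  have [|m wm m0] := @avoiding_path w (s ++ s') _ br.
    by move=> a; rewrite mem_cat => /orP[/sP|/sP'].
  have kill r : {subset r <= s ++ s'} ->
      lpa_ghost w m ** (\sum_(a <- r) a) ** lpa_path w m = 0.
    move=> rs; rewrite bmul_sumr bmul_suml big_seq big1 // => a /rs.
    exact: m0.
  left; exists (path_end w m); have := conj_xy m wm.
  rewrite xE yE !kill ?addr0 // => a; rewrite mem_cat => ->; rewrite ?orbT //.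
move=> /existsNP [m /not_implyP [wm nbr]].
apply: (@linear_conclusion (path_end w m)); last exact: conj_xy.
- move=> n e f mn src_e src_f; apply: contrapT => ef; apply: nbr.
  exists n => // g; rewrite path_end_cat => src_g.
  have [ge|ge] := eqVneq g e; last by exists e => // eg; rewrite eg eqxx in ge.
  by exists f => // fg; apply: ef; rewrite fg ge.
- apply: span_sandwich xP => a; exact: conj_loop_elt.
- apply: span_sandwich yP => a; exact: conj_loop_elt.
Qed.

End LeavittPathAlgebra.

Theorem lemma4p6 (E : digraph) (hE : row_finite E)
    (rho : lpa E -> lpa E -> Prop) (hrho : congruence rho)
    (hdiag : ~ (forall a b : lpa E, rho a b <-> a = b)) :
  (exists v : vertex E, rho (lpa_v v) 0) \/
  (exists (v : vertex E) (c : seq (edge E)) (p q : laurent),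
     [/\ is_cycle v c, (~ exists f : edge E, is_exit c f), p <> q &
         rho (laurent_eval v c p) (laurent_eval v c q)]).
Proof.
have [w [x [y [xP yP xy]]]] := vertex_plus_loops_related hE hrho hdiag.
exact: (dichotomy hrho xP yP xy).
Qed.
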